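(* Let $X$ be a set endowed with two arbitrary single-valued binary operations $+$ and $\times$ and two fixed different points $\xi_0,\xi_1\in X$. Denote by $S'(X)$ (resp. $S'(X)_{pr}$) the set of all (resp. all proper) l-prime ideals in $(X,+,\times)$. Let $\mathcal{T}^+$ (resp. $\mathcal{T}^-$) be the topology on $S'(X)$ having as a subbase the sets $\{p\in S'(X): x\notin p\}$ (resp. $\{p\in S'(X): x\in p\}$), $x\in X$, and define the topologies $\mathcal{T}^+_{pr}$ and $\mathcal{T}^-_{pr}$ on $S'(X)_{pr}$ in the same way, with $S'(X)_{pr}$ in place of $S'(X)$. Then the bitopological spaces $(S'(X),\mathcal{T}^+,\mathcal{T}^-)$ and $(S'(X)_{pr},\mathcal{T}^+_{pr},\mathcal{T}^-_{pr})$ are abstract spectra.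
   Context: A subset $p\subseteq X$ is an l-prime ideal in $(X,+,\times)$ if for all $x,y\in X$: (i) $x+y\in p$ iff $x\in p$ and $y\in p$; (ii) $x\times y\in p$ iff $x\in p$ or $y\in p$. It is proper if $\xi_0\in p$ and $\xi_1\notin p$. The topology with a given family as subbase is the one generated by that family (the whole set is the empty intersection). Compact means that every open cover has a finite subcover. For a bitopological space $(S,\mathcal{T}^+,\mathcal{T}^-)$ (a set with two topologies) put $\mathcal{L}^+=\{U\in\mathcal{T}^+: S\setminus U\in\mathcal{T}^-\}$ and $\mathcal{L}^-=\{U\in\mathcal{T}^-: S\setminus U\in\mathcal{T}^+\}$. A non-empty bitopological space is an abstract spectrum if: (SP1) $\mathcal{L}^+$ is a base for $\mathcal{T}^+$ and $\mathcal{L}^-$ is a base for $\mathcal{T}^-$; (SP2) if $F\subseteq S$ and $S\setminus F\in\mathcal{T}^+$ (resp. $S\setminus F\in\mathcal{T}^-$) then $F$ is a compact subset of $(S,\mathcal{T}^-)$ (resp. of $(S,\mathcal{T}^+)$); (SP3) at least one of $(S,\mathcal{T}^+)$, $(S,\mathcal{T}^-)$ is a $T_0$-space.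
   Formalization: The claim for S'(X)_pr is stated under the assumption that S'(X)_pr is non-empty; it can be empty (for instance when x+y is always ξ0), and an abstract spectrum is non-empty by definition. *)

(* Defs.v *)
From HB Require Import structures.
From mathcomp Require Import all_boot all_order all_classical.
From mathcomp Require Import topology_structure compact separation_axioms.

Set Implicit Arguments.
Unset Strict Implicit.
Unset Printing Implicit Defensive.

Local Open Scope classical_set_scope.

(* A bitopological space is a type with two topologies on it; as in
   [sup_topology], these are terms of type [Topological S], and [Topological.Pack]
   turns each of them into a topologicalType with carrier S. *)

Definition open_coopen (S : Type) (T1 T2 : Topological S) : set (set S) :=
  [set U | @open (Topological.Pack T1) U /\ @open (Topological.Pack T2) (~` U)].

Definition abstract_spectrum (S : Type) (Tp Tm : Topological S) : Prop :=
  let Sp := Topological.Pack Tp in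
  let Sm := Topological.Pack Tm in
  [/\ [set: S] !=set0,
      @basis Sp (open_coopen Tp Tm) /\ @basis Sm (open_coopen Tm Tp),
      (forall F : set S, @open Sp (~` F) -> @cover_compact Sm F) /\
      (forall F : set S, @open Sm (~` F) -> @cover_compact Sp F)
    & kolmogorov_space Sp \/ kolmogorov_space Sm].

Definition generated (S : choiceType) (B : set (set S)) : Type := S.

HB.instance Definition _ (S : choiceType) (B : set (set S)) :=
  Choice.on (generated B).
HB.instance Definition _ (S : choiceType) (B : set (set S)) :=
  isSubBaseTopological.Build (generated B) B id.

Definition generated_topology (S : choiceType) (B : set (set S)) :
    Topological S := Topological.class (generated B).

Section LPrime.
Variables (X : Type) (add mul : X -> X -> X) (xi0 xi1 : X).

Definition l_prime (p : set X) : Prop :=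
  (forall x y, p (add x y) <-> p x /\ p y) /\
  (forall x y, p (mul x y) <-> p x \/ p y).

Definition proper_ideal (p : set X) : Prop := p xi0 /\ ~ p xi1.

Definition l_primes : set (set X) := [set p | l_prime p].

(* Possibly empty: if [add] is constantly [xi0], then [xi0 \in p] forces
   [xi1 \in p], so there is no proper l-prime ideal. *)
Definition proper_l_primes : set (set X) :=
  [set p | l_prime p /\ proper_ideal p].

End LPrime.

(* The topologies T^+ and T^- on a family P of subsets of X, regarded as a
   type through the coercion of [set (set X)] to types. *)

Definition plus_topology (X : Type) (P : set (set X)) : Topological P :=
  generated_topology [set [set p : P | ~ val p x] | x in [set: X]].

Definition minus_topology (X : Type) (P : set (set X)) : Topological P :=
  generated_topology [set [set p : P | val p x] | x in [set: X]].

(* Main.v *)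
(** An ultrafilter [G] on a family [P] of subsets of [X] determines the set
    of all [x] such that [G]-almost every [p] contains [x].  Ultrafilters
    commute with finite conjunctions and disjunctions, so this set is again a (proper)
    l-prime ideal when [P] consists of such ideals, and it is then a limit of
    [G] for T^+ and T^- simultaneously.  Hence a set that is closed for one of
    the two topologies contains limits, for the other one, of all ultrafilters
    it belongs to.  The rest holds for every family [P]: the subbasic sets of
    T^+ and T^- are complementary and separate the points. *)

Require Import Defs.
From mathcomp Require Import all_boot all_order all_classical.
From mathcomp Require Import finmap.
From mathcomp Require Import topology_structure compact separation_axioms.

Local Open Scope classical_set_scope.

Lemma open_generated (S : choiceType) (B : set (set S)) (U : set S) :
  @open (Topological.Pack (generated_topology B)) U <->
  exists2 D : set (set S), D `<=` finI_from B id & \bigcup_(V in D) V = U.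
Proof. by []. Qed.

Lemma subbase_open (S : choiceType) (B : set (set S)) (U : set S) :
  B U -> @open (Topological.Pack (generated_topology B)) U.
Proof.
move=> BU; apply/open_generated; exists [set U]; last exact: bigcup_set1.
by move=> _ ->; apply: (@finI_from1 _ _ B id).
Qed.

Lemma nbhs_generated (S : choiceType) (B : set (set S)) (x : S) (A : set S) :
  @nbhs _ (Topological.Pack (generated_topology B)) x A ->
  exists2 E : {fset set S}, {subset E <= B} &
    (\bigcap_(V in [set` E]) V) x /\ \bigcap_(V in [set` E]) V `<=` A.
Proof.
rewrite nbhsE => -[U [/open_generated[D DB <-] [V DV Vx]] UA].
have [E EB EV] := DB _ DV.
by exists E => //; rewrite EV; split=> // y Vy; apply: UA; exists V.
Qed.

(** Filters are stable under finite intersections, so convergence may be tested on subbasic sets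
    alone. *)
Lemma generated_cvg (S : choiceType) (B : set (set S)) (F : set_system S)
    (x : S) : Filter F -> (forall U, B U -> U x -> F U) ->
  @nbhs _ (Topological.Pack (generated_topology B)) x `<=` F.
Proof.
move=> FF FB A /nbhs_generated[E EB [Ex EA]]; apply: filterS EA _.
apply: filter_bigI => V VE; apply: FB; last exact: Ex.
by apply: set_mem; apply: EB.
Qed.

(** By De Morgan, the complement of a finite intersection of subbasic sets is a union of [T]-open
    sets. *)
Lemma basis_generated (S : choiceType) (B : set (set S)) (T : Topological S) :
  (forall U, B U -> @open (Topological.Pack T) (~` U)) ->
  @basis (Topological.Pack (generated_topology B))
    (open_coopen (generated_topology B) T).
Proof.
move=> BT; split=> [U []//|x A /nbhs_generated[E EB [Ex EA]]].
exists (\bigcap_(V in [set` E]) V) => //; split=> //; split.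
  apply/open_generated; exists [set \bigcap_(V in [set` E]) V].
    by move=> _ ->; exists E.
  exact: bigcup_set1.
rewrite setC_bigcap; apply: bigcup_open => V VE; apply: BT.
by apply: set_mem; apply: EB.
Qed.

(* [compact_cover] is not applicable: it requires a pointed space. *)
Lemma closed_cover_compact (S : Type) (T1 T2 : Topological S) (F : set S) :
    (forall G : set_system S, UltraFilter G -> exists p : S,
      @nbhs _ (Topological.Pack T1) p `<=` G /\
      @nbhs _ (Topological.Pack T2) p `<=` G) ->
  @open (Topological.Pack T1) (~` F) -> @cover_compact (Topological.Pack T2) F.
Proof.
move=> lim oF I D f fo Ff; apply: contrapT => nfin.
(* The parts of [F] missed by finite subfamilies are nonempty when there is no finite subcover, and
   they form a filter base; [G] will be an ultrafilter refining it. *)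
pose rest (E : {fset I}) := F `\` cover [set` E] f.
have rest_proper : ProperFilter
    (filter_from [set E : {fset I} | {subset E <= D}] rest).
  apply: filter_from_proper => [|E ED]; last first.
    apply/set0P/eqP => rest0; apply: nfin; exists E => // x Fx.
    by apply: contrapT => nEx; have : set0 x by rewrite -rest0.
  apply: filter_from_filter => [|E1 E2 E1D E2D]; first by exists fset0.
  exists (E1 `|` E2)%fset => [i|]; first by rewrite inE => /orP[/E1D|/E2D].
  rewrite /rest /cover set_fsetU bigcup_setU => x [Fx nEx].
  by split; split=> // Ex; apply: nEx; [left|right].
have [G [UG restG]] := ultraFilterLemma rest_proper.
have [p [G1 G2]] := lim G UG.
(* Convergence for [T1] forces the limit into [F], because [rest fset0] is [F] itself. *)
have [Fp|nFp] := pselect (F p); last first.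
  have : G (~` F) by apply: G1; apply: open_nbhs_nbhs.
  have : G (rest fset0) by apply: restG; exists fset0.
  move=> Gr /(filterI Gr) Gr0; apply: (@filter_not_empty _ G).
  by apply: filterS Gr0 => x [[]].
(* Convergence for [T2] puts [f i] in [G], yet [f i] is disjoint from [rest [fset i]]. *)
have [i Di fip] := Ff p Fp.
have Gf : G (f i) by apply: G2; apply: open_nbhs_nbhs; split=> //; exact: fo.
have Gr : G (rest [fset i]%fset).
  apply: restG; exists [fset i]%fset => // j.
  by rewrite inE => /eqP ->; apply: mem_set.
apply: (@filter_not_empty _ G); apply: filterS2 Gr Gf => x [_ nfx] fx.
by apply: nfx; exists i => //=; rewrite inE.
Qed.

Definition ultralimit {X : Type} {P : set (set X)} (G : set_system P) : set X :=
  [set x | G [set p : P | val p x]].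

Lemma abstract_spectrum_ultralimit (X : Type) (P : set (set X)) :
    P !=set0 -> (forall G : set_system P, UltraFilter G -> P (ultralimit G)) ->
  abstract_spectrum (plus_topology P) (minus_topology P).
Proof.
move=> [p0 Pp0] Plim.
have lim (G : set_system P) : UltraFilter G -> exists p : P,
    @nbhs _ (Topological.Pack (plus_topology P)) p `<=` G /\
    @nbhs _ (Topological.Pack (minus_topology P)) p `<=` G.
  move=> UG; exists (SigSub (mem_set (Plim G UG))); split.
    (* For T^+ the dichotomy of ultrafilters is needed; for T^- the claim is the definition of
       [ultralimit]. *)
    apply: generated_cvg => _ [x _ <-] /= nGx.
    by have [|] := in_ultra_setVsetC [set p : P | val p x] UG.
  by apply: generated_cvg => _ [x _ <-].
split.
- by exists (SigSub (mem_set Pp0)).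
- split; apply: basis_generated => _ [x _ <-]; apply: subbase_open.
    by exists x => //; apply/seteqP; split=> p /=; [move=> ? |move/contrapT].
  by exists x.
- split=> F; apply: closed_cover_compact => // G UG.
  by have [p []] := lim G UG; exists p.
- left=> p q pq.
  (* T^+ is T0: a point [x] on which two members of [P] differ gives a T^+-neighbourhood of the one
     omitting [x]. *)
  have sep (r s : P) x : ~ val r x -> val s x -> exists A : set P,
      A \in @nbhs _ (Topological.Pack (plus_topology P)) r /\ s \in ~` A.
    move=> nrx sx; exists [set t : P | ~ val t x]; split; apply: mem_set.
      by apply: open_nbhs_nbhs; split=> //; apply: subbase_open; exists x.
    exact.
  have [x [[px nqx]|[qx npx]]] : exists x : X,
      (val p x /\ ~ val q x) \/ (val q x /\ ~ val p x).
  + apply: contrapT => npq; move/eqP: pq; apply; apply: val_inj.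
    apply/seteqP; split=> x rx; apply: contrapT => nrx; apply: npq; exists x.
      by left.
    by right.
  + by have [A] := sep q p x nqx px; exists A; right.
  + by have [A] := sep p q x npx qx; exists A; left.
Qed.

Lemma l_prime_ultralimit (X : Type) (add mul : X -> X -> X) (P : set (set X))
    (G : set_system P) : UltraFilter G ->
  (forall p, P p -> l_prime add mul p) -> l_prime add mul (ultralimit G).
Proof.
move=> UG PX.
have PXv (p : P) : l_prime add mul (val p) by exact/PX/set_valP.
split=> x y; split=> /=.
- by move=> Gxy; split; apply: filterS Gxy => p /(PXv p).1 [].
- by move=> [Gx Gy]; apply: filterS2 Gx Gy => p px py; apply/(PXv p).1.
(* If [G]-almost every [p] contains the product but omits [x], then it contains [y]. *)
- move=> Gxy; have [|nGx] := in_ultra_setVsetC [set p : P | val p x] UG.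
    by left.
  by right; apply: filterS2 Gxy nGx => p /(PXv p).2 [].
- by move=> [] Gxy; apply: filterS Gxy => p pxy; apply/(PXv p).2;
    [left|right].
Qed.

Theorem theorem2p2p8 (X : Type) (add mul : X -> X -> X) (xi0 xi1 : X)
    (xi0_neq_xi1 : xi0 <> xi1) :
  abstract_spectrum (plus_topology (l_primes add mul))
                    (minus_topology (l_primes add mul)) /\
  (proper_l_primes add mul xi0 xi1 !=set0 ->
   abstract_spectrum (plus_topology (proper_l_primes add mul xi0 xi1))
                     (minus_topology (proper_l_primes add mul xi0 xi1))).
Proof.
split=> [|proper_neq0]; apply: abstract_spectrum_ultralimit => //.
(* The empty set is always l-prime. *)
- by exists set0; split=> x y; split=> //= -[].
- by move=> G UG; apply: l_prime_ultralimit.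
- move=> G UG; split; first by apply: l_prime_ultralimit => p [].
  split.
    by apply: filterE => p; have [_ []] := set_valP p.
  (* No proper [p] contains [xi1], so [G1] would put the empty set in [G]. *)
  move=> G1; apply: (@filter_not_empty _ G); apply: filterS G1 => p.
  by have [_ []] := set_valP p.
Qed.
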